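(* Let $M:\mathbb{R}^l\times\mathbb{R}^n\rightrightarrows\mathbb{R}^m$ be a set-valued mapping, $S(p):=\{x\in\mathbb{R}^n\mid0\in M(p,x)\}$, and assume that $M$ has locally closed graph around $(\bar p,\bar x,0)\in\mathrm{gph}\,M$. If $$0\in DM(\bar p,\bar x,0)(0,u)\ \Rightarrow\ u=0,$$ then $S$ has the isolated calmness property at $(\bar p,\bar x)$. Conversely, if there is some $u\neq0$ such that $0\in DM(\bar p,\bar x,0)(0,u)$ and $M$ is metrically subregular in direction $(0,u)$ at $(\bar p,\bar x,0)$, then $S$ does not have the isolated calmness property at $(\bar p,\bar x)$.
   Context: $T_\Omega(\bar z):=\{u\mid\exists u_k\to u,\ t_k\downarrow0:\ \bar z+t_ku_k\in\Omega\ \forall k\}$ is the tangent cone. The graphical derivative of $M$ at $(\bar p,\bar x,0)\in\mathrm{gph}\,M$ is $DM(\bar p,\bar x,0)(q,u):=\{v\mid(q,u,v)\in T_{\mathrm{gph}\,M}(\bar p,\bar x,0)\}$. For a direction $d_0$ and $\rho,\delta>0$ let $\mathcal{V}_{\rho,\delta}(d_0):=\{d\mid\|d\|\le\rho,\ \big\|\|d_0\|d-\|d\|d_0\big\|\le\delta\|d_0\|\|d\|\}$; a directional neighborhood of $d_0$ is a set containing some $\mathcal{V}_{\rho,\delta}(d_0)$. A mapping $F$ is metrically subregular in direction $d_0$ at $(\bar y,\bar z)\in\mathrm{gph}\,F$ if there are a directional neighborhood $\mathcal{U}$ of $d_0$ and $\kappa\ge0$ such that $\mathrm{dist}(y,F^{-1}(\bar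 z))\le\kappa\,\mathrm{dist}(\bar z,F(y))$ for all $y\in\bar y+\mathcal{U}$ (with $\mathrm{dist}(\cdot,\emptyset)=\infty$). Here this is applied to $F=M$, $\bar y=(\bar p,\bar x)$, $\bar z=0$. $S$ has the isolated calmness property at $(\bar p,\bar x)\in\mathrm{gph}\,S$ if there are a neighborhood $U$ of $\bar x$, a neighborhood $V$ of $\bar p$ and $L\ge0$ such that $S(p)\cap U\subset\{\bar x\}+L\|p-\bar p\|\mathcal{B}$ for all $p\in V$, where $\mathcal{B}$ is the closed unit ball. *)

(* Defs.v *)
From HB Require Import structures.
From mathcomp Require Import all_boot all_order all_algebra.
From mathcomp Require Import all_classical all_reals all_analysis.
Import Order.TTheory GRing.Theory Num.Theory.
Import numFieldNormedType.Exports.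
Set Implicit Arguments.
Unset Strict Implicit.
Unset Printing Implicit Defensive.
Local Open Scope classical_set_scope.
Local Open Scope ring_scope.

(* The library norm on row vectors and on products is the sup norm, so the
   Euclidean norms are defined here.  Notions in which a norm occurs explicitly
   take it as a parameter; limits, neighborhoods and closed sets refer to the
   library topology, which is the one induced by these norms. *)
Definition enorm (R : realType) (n : nat) (x : 'rV[R]_n) : R :=
  Num.sqrt (\sum_(i < n) x 0 i ^+ 2).

Definition prod_enorm (R : realType) (l n : nat)
    (y : 'rV[R]_l * 'rV[R]_n) : R :=
  Num.sqrt (enorm y.1 ^+ 2 + enorm y.2 ^+ 2).

(* Equal to +oo when C is empty. *)
Definition dist (R : realType) (V : zmodType) (N : V -> R) (y : V)
    (C : set V) : \bar R :=
  ereal_inf [set (N (y - c))%:E | c in C].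

Definition gph (Y Z : Type) (F : Y -> set Z) : set (Y * Z) :=
  [set w | F w.1 w.2].

Definition inverse_map (Y Z : Type) (F : Y -> set Z) (z : Z) : set Y :=
  [set y | F y z].

Definition locally_closed_around (T : topologicalType) (A : set T) (a : T) :
    Prop :=
  exists W : set T, [/\ nbhs a W, closed W & closed (A `&` W)].

(* t_k decreasing to 0 is read as usual in variational analysis: positive and
   tending to 0; passing to a subsequence makes it monotone. *)
Definition tangent_cone (R : realType) (V : normedModType R) (Omega : set V)
    (zbar : V) : set V :=
  [set u | exists (u_ : nat -> V) (t_ : nat -> R),
    [/\ u_ @ \oo --> u,
        (forall k, 0 < t_ k),
        t_ @ \oo --> (0 : R) &
        forall k, Omega (zbar + t_ k *: u_ k)]].

Definition graphical_derivative (R : realType) (Y Z : normedModType R)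
    (F : Y -> set Z) (ybar : Y) (zbar : Z) (d : Y) : set Z :=
  [set v | tangent_cone (gph F) (ybar, zbar) (d, v)].

Definition dir_cone (R : realType) (V : lmodType R) (N : V -> R)
    (rho delta : R) (d0 : V) : set V :=
  [set d | N d <= rho /\
           N (N d0 *: d - N d *: d0) <= delta * N d0 * N d].

Definition directional_nbhd (R : realType) (V : lmodType R) (N : V -> R)
    (d0 : V) (U : set V) : Prop :=
  exists rho delta : R,
    [/\ 0 < rho, 0 < delta & dir_cone N rho delta d0 `<=` U].

(* In the library 0 * +oo = 0.  This is harmless here: kappa is existentially
   quantified, and may be replaced by any larger, hence nonzero, constant. *)
Definition metrically_subregular_dir (R : realType) (Y Z : lmodType R)
    (NY : Y -> R) (NZ : Z -> R) (F : Y -> set Z) (d0 ybar : Y) (zbar : Z) :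
    Prop :=
  exists (U : set Y) (kappa : R),
    [/\ directional_nbhd NY d0 U, 0 <= kappa &
        forall y, [set ybar + d | d in U] y ->
          (dist NY y (inverse_map F zbar) <= kappa%:E * dist NZ zbar (F y))%E].

Definition isolated_calmness (R : realType) (l n : nat)
    (S : 'rV[R]_l -> set 'rV[R]_n) (pbar : 'rV[R]_l) (xbar : 'rV[R]_n) :
    Prop :=
  exists (U : set 'rV[R]_n) (V : set 'rV[R]_l) (L : R),
    [/\ nbhs xbar U, nbhs pbar V, 0 <= L &
        forall p, V p ->
          S p `&` U `<=`
            [set xbar + (L * enorm (p - pbar)) *: b
               | b in [set b : 'rV[R]_n | enorm b <= 1]]].

Definition solution_map (R : realType) (l n m : nat)
    (M : 'rV[R]_l * 'rV[R]_n -> set 'rV[R]_m) (p : 'rV[R]_l) :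
    set 'rV[R]_n :=
  [set x | M (p, x) 0].

(* Main.v *)
Require Import Defs.
From HB Require Import structures.
From mathcomp Require Import all_boot all_order all_algebra.
From mathcomp Require Import all_classical all_reals all_analysis.
Import Order.TTheory GRing.Theory Num.Theory.
Import numFieldNormedType.Exports.
Local Open Scope classical_set_scope.
Local Open Scope ring_scope.

(** Both implications come from one sharp criterion, applied to the solution
    map [S] itself: [S] has the isolated calmness property at [(pbar, xbar)]
    if and only if [DS(pbar, xbar)(0)] contains no nonzero vector
    ([isolated_calmness_graphical_derivativeP]).  If calmness fails, there are
    points [x] in [S p] arbitrarily close to [xbar] for which [p - pbar] is
    negligible compared with [x - xbar]; normalizing [x - xbar] and using
    compactness of the unit sphere produces a unit vector in [DS(0)].
    Conversely, a tangent [(0, u)] to the graph of [S] with [u] nonzero yields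
    points [x] in [S p] for which [p - pbar] is negligible compared with
    [x - xbar], which no Lipschitz bound allows.

    It remains to compare [DS] with [DM].  The graph of [S] is the preimage
    [M^-1(0)], and a tangent to [F^-1(z)] is always a direction along which
    [DF] takes the value [0], since the values of [F] may be kept equal to [z]
    ([tangent_cone_inverse_map]).  This gives the first implication.  The
    second one needs the reverse inclusion in the single direction [(0, u)]
    ([subregular_dir_tangent]).  If [0] lies in [DF(d0)], there are points
    [y + t w], with [w] close to [d0], where [F] has a value at distance [o(t)] from
    [z]; they eventually enter the directional neighborhood of [d0], so metric
    subregularity moves them into [F^-1(z)] at a cost of [o(t)], which does not
    change the limit direction.

    Tangency is always established in the form of [tangent_coneP], with an
    arbitrary tolerance in place of sequences.  Calmness is measured with
    Euclidean norms and tangency with the sup norm: on row vectors the two are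
    equivalent, which only alters the calmness constant
    ([isolated_calmnessP]). *)

(** * Euclidean norms against sup norms *)

Section EuclideanNorms.
Variable R : realType.
Implicit Types l n : nat.

Lemma enorm_ge0 n (x : 'rV[R]_n) : 0 <= enorm x.
Proof. exact: sqrtr_ge0. Qed.

Lemma enormZ n (t : R) (x : 'rV[R]_n) : enorm (t *: x) = `|t| * enorm x.
Proof.
rewrite /enorm -sqrtr_sqr -sqrtrM ?sqr_ge0 // mulr_sumr.
by congr Num.sqrt; apply: eq_bigr => i _; rewrite mxE exprMn.
Qed.

Lemma normr_coord_le n (x : 'rV[R]_n) i : `|x 0 i| <= `|x|.
Proof.
rewrite [leRHS]mx_normrE.
by rewrite (le_bigmax _ (fun ij : 'I_1 * 'I_n => `|x ij.1 ij.2|) (0, i)).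
Qed.

Lemma normr_le_enorm n (x : 'rV[R]_n) : `|x| <= enorm x.
Proof.
rewrite [leLHS]mx_normrE; apply: bigmax_le; first exact: enorm_ge0.
move=> [i j] _ /=; rewrite (ord1 i) -sqrtr_sqr; apply: ler_wsqrtr.
rewrite (bigD1 j) //= lerDl; apply: sumr_ge0 => k _; exact: sqr_ge0.
Qed.

Lemma enorm_le_normr n (x : 'rV[R]_n) : enorm x <= Num.sqrt n%:R * `|x|.
Proof.
rewrite -[X in _ * X](ger0_norm (normr_ge0 x)) -sqrtr_sqr -sqrtrM ?ler0n //.
apply: ler_wsqrtr.
rewrite mulr_natl -[n in _ *+ n]card_ord -sumr_const.
apply: ler_sum => i _; rewrite -[leLHS]real_normK ?num_real//.
by rewrite lerXn2r ?nnegrE// normr_coord_le.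
Qed.

Lemma continuous_enorm n : continuous (@enorm R n).
Proof.
move=> x; apply: (@continuous_comp _ _ _ _ (@Num.sqrt R)).
  have := @continuous_big R _ (@GRing.add R) 0 xpredT (@add_continuous R).
  apply => i _ z.
  apply: (@continuous_comp _ _ _ (fun z : 'rV[R]_n => z 0 i) (fun r : R => r ^+ 2)).
    exact: coord_continuous.
  exact: exprn_continuous.
exact: sqrt_continuous.
Qed.

Lemma prod_enormZ l n (t : R) (y : 'rV[R]_l * 'rV[R]_n) :
  prod_enorm (t *: y) = `|t| * prod_enorm y.
Proof.
rewrite /prod_enorm /= !enormZ !exprMn -mulrDr sqrtrM ?sqr_ge0//.
by rewrite sqrtr_sqr normr_id.
Qed.

Lemma normr_le_prod_enorm l n (y : 'rV[R]_l * 'rV[R]_n) :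
  `|y| <= prod_enorm y.
Proof.
rewrite prod_normE ge_max; apply/andP; split;
  apply: (le_trans (normr_le_enorm _ _));
  rewrite -[leLHS](ger0_norm (enorm_ge0 _ _)) -sqrtr_sqr;
  by apply: ler_wsqrtr; rewrite ?lerDl ?lerDr sqr_ge0.
Qed.

Lemma continuous_prod_enorm l n : continuous (@prod_enorm R l n).
Proof.
move=> y; apply: (@continuous_comp _ _ _
  (fun y : 'rV[R]_l * 'rV[R]_n => enorm y.1 ^+ 2 + enorm y.2 ^+ 2)
  (@Num.sqrt R)); last exact: sqrt_continuous.
have sqr_cvg k (f : 'rV[R]_l * 'rV[R]_n -> 'rV[R]_k) :
    f @ y --> f y -> enorm (f z) ^+ 2 @[z --> y] --> enorm (f y) ^+ 2.
  move=> f_cvg; apply: (@cvg_comp _ _ _ _ (fun r : R => r ^+ 2)).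
    by apply: (cvg_comp _ _ f_cvg); exact: continuous_enorm.
  exact: exprn_continuous.
by apply: cvgD; apply: sqr_cvg; [exact: cvg_fst|exact: cvg_snd].
Qed.

End EuclideanNorms.

(** * Tangent cones without sequences *)

Section TangentCone.
Variables (R : realType) (V : normedModType R).

(** Countable choice over the tolerances [1 / (k + 1)] recovers the sequences.
    In this form a cluster point of difference quotients is directly a tangent,
    without passing to a convergent subsequence. *)
Lemma tangent_coneP (Omega : set V) (zbar u : V) :
  tangent_cone Omega zbar u <->
  forall e : R, 0 < e -> exists t w,
    [/\ 0 < t < e, `|u - w| < e & Omega (zbar + t *: w)].
Proof.
split=> [[u_ [t_ [u_cvg t_gt0 t_cvg Omega_ut]]] e e_gt0|approx].
  have u_near : \forall k \near \oo, `|u - u_ k| < e.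
    by move/cvgrPdist_lt: u_cvg; exact.
  have t_near : \forall k \near \oo, `|t_ k| < e by exact: cvgr0_norm_lt.
  have [k [ut tt]] := filter_ex (filterI u_near t_near).
  by exists (t_ k), (u_ k); split=> //; rewrite t_gt0 -[t_ k]gtr0_norm.
have harm_gt0 k : 0 < harmonic k :> R by rewrite invr_gt0.
have /choice[t_ /choice[u_ utP]] k := approx (harmonic k) (harm_gt0 k).
exists u_, t_; split.
- apply/cvgrPdist_lt => e e_gt0; near=> k.
  have [_ /lt_trans + _] := utP k; apply.
  near: k; exact: (near_infty_natSinv_lt (PosNum e_gt0)).
- by move=> k; have [/andP[]] := utP k.
- apply/cvgr0Pnorm_lt => e e_gt0; near=> k.
  have [/andP[t_gt0 /lt_trans t_lt] _ _] := utP k.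
  rewrite gtr0_norm//; apply: t_lt.
  near: k; exact: (near_infty_natSinv_lt (PosNum e_gt0)).
- by move=> k; have [] := utP k.
Unshelve. all: by end_near. Qed.

End TangentCone.

(** * Isolated calmness and the graphical derivative *)

Section Calmness.
Variables (R : realType) (l n : nat) (S : 'rV[R]_l -> set 'rV[R]_n).
Variables (pbar : 'rV[R]_l) (xbar : 'rV[R]_n).

(** The sup norm is at most the Euclidean norm, which is at most a fixed
    multiple of it; hence the choice of norm only affects the constant. *)
Lemma isolated_calmnessP :
  isolated_calmness S pbar xbar <->
  exists e L : R, [/\ 0 < e, 0 <= L & forall p x, `|p - pbar| < e ->
    `|x - xbar| < e -> S p x -> `|x - xbar| <= L * `|p - pbar|].
Proof.
split=> [[U [V [L [xU pV L_ge0 calm]]]]|[e [L [e_gt0 L_ge0 calm]]]].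
  have /nbhs_ballP[a /= a_gt0 aU] := xU.
  have /nbhs_ballP[b /= b_gt0 bV] := pV.
  exists (Num.min a b), (L * Num.sqrt l%:R); split.
  - by rewrite lt_min a_gt0.
  - by rewrite mulr_ge0// sqrtr_ge0.
  move=> p x; rewrite !lt_min => /andP[_ pb] /andP[xa _] Spx.
  have [] := calm p _ x.
  - by apply: bV; rewrite -ball_normE /ball_/= distrC.
  - by split=> //; apply: aU; rewrite -ball_normE /ball_/= distrC.
  move=> c /= c_le1 <-; rewrite addrC addKr normrZ ger0_norm; last first.
    by rewrite mulr_ge0// enorm_ge0.
  rewrite -mulrA -mulrA ler_wpM2l//.
  rewrite -[leRHS]mulr1 ler_pM ?enorm_ge0 ?enorm_le_normr//.
  exact: le_trans (normr_le_enorm _ _ _) c_le1.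
exists (ball xbar e), (ball pbar e), (Num.sqrt n%:R * L).
split; try exact: nbhsx_ballx; first by rewrite mulr_ge0 ?sqrtr_ge0.
move=> p + x [Spx]; rewrite -!ball_normE /ball_/= => pe xe.
have x_le : `|x - xbar| <= L * `|p - pbar|.
  by apply: calm; rewrite // distrC.
set c := _ * enorm _.
have x_lec : enorm (x - xbar) <= c.
  apply: (le_trans (enorm_le_normr _ _ _)); rewrite /c -mulrA.
  rewrite ler_wpM2l ?sqrtr_ge0//; apply: (le_trans x_le).
  by rewrite ler_wpM2l// normr_le_enorm.
(* The radius [c] vanishes only if [x = xbar], and then [0] serves as [b]. *)
have [c0|c_neq0] := eqVneq c 0.
  exists 0; first by rewrite /= -(scale0r 0) enormZ normr0 mul0r.
  apply/esym/eqP; rewrite scaler0 addr0 -subr_eq0 -normr_le0.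
  by rewrite -c0 (le_trans (normr_le_enorm _ _ _)).
have c_gt0 : 0 < c by rewrite lt0r c_neq0 (le_trans (enorm_ge0 _ _ _) x_lec).
exists (c^-1 *: (x - xbar)).
  by rewrite /= enormZ gtr0_norm ?invr_gt0// mulrC ler_pdivrMr ?mul1r.
by rewrite scalerA divff// scale1r addrC subrK.
Qed.

(** A tangent direction [(0, u)] would give solutions whose distance to [xbar]
    is of order [t * `|u|] for parameters at distance [o(t)] from [pbar]. *)
Lemma isolated_calmness_graphical_derivative u :
  isolated_calmness S pbar xbar ->
  graphical_derivative S pbar xbar 0 u -> u = 0.
Proof.
move=> /isolated_calmnessP[e [L [e_gt0 L_ge0 calm]]].
move=> /tangent_coneP approx; apply/eqP; apply: contraPT isT => u_neq0.
have u_gt0 : 0 < `|u| by rewrite normr_gt0.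
have u1_gt0 : 0 < `|u| + 1 by rewrite addr_gt0.
have L1_gt0 : 0 < L + 1 by rewrite ltr_wpDl.
(* The bounds on [d] keep [t *: q] and [t *: v] within the calmness radius [e],
   and contradict [`|u| <= `|v| + `|u - v| <= L * `|q| + `|u - v| < (L + 1) * d]. *)
pose d := Num.min 1 (Num.min (e / (`|u| + 1)) (`|u| / (L + 1))).
have d_gt0 : 0 < d by rewrite !lt_min !divr_gt0 ?ltr01.
have [t [[q v] []]] := approx d d_gt0.
rewrite prod_normE /= gt_max sub0r normrN => /andP[t_gt0 t_lt].
move=> /andP[q_lt v_lt] Sqv.
have d_le1 : d <= 1 by rewrite !ge_min lexx.
have d_lee : d <= e / (`|u| + 1) by rewrite !ge_min lexx orbT.
have d_leL : d <= `|u| / (L + 1) by rewrite !ge_min lexx !orbT.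
have tl : t * (`|u| + 1) < e.
  by rewrite -ltr_pdivlMr//; exact: lt_le_trans d_lee.
have v_le : `|v| <= `|u| + 1.
  have := ler_normD u (v - u); rewrite addrC subrK distrC => /le_trans; apply.
  by rewrite lerD2l ltW// (lt_le_trans v_lt).
have := calm (pbar + t *: q) (xbar + t *: v); rewrite !(addrC _ (t *: _)) !addrK.
rewrite !normrZ gtr0_norm// mulrCA ler_pM2l//.
rewrite ![_ + pbar]addrC ![_ + xbar]addrC.
have q_le : `|q| <= `|u| + 1.
  by rewrite (le_trans (ltW q_lt))// (le_trans d_le1)// lerDr.
have tq : t * `|q| < e by apply: le_lt_trans tl; rewrite ler_pM2l.
have tv : t * `|v| < e by apply: le_lt_trans tl; rewrite ler_pM2l.
move=> /(_ tq tv Sqv) vq.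
have : `|u| < `|u|.
  have := ler_normD v (u - v); rewrite addrC subrK => /le_lt_trans; apply.
  have : L * `|q| + `|u - v| < (L + 1) * d.
    by rewrite mulrDl mul1r ler_ltD// ler_wpM2l// ltW.
  move=> h; apply: (le_lt_trans (lerD vq (lexx _))); apply: (lt_le_trans h).
  by rewrite mulrC -ler_pdivlMr.
by rewrite ltxx.
Qed.

(** Failure of calmness for every constant gives solutions [x] for which
    [p - pbar] is negligible compared with [x - xbar]; a cluster point of the
    normalized differences [x - xbar] lies in [DS(0)] and has norm one. *)
Lemma graphical_derivative_isolated_calmness :
  (forall u, graphical_derivative S pbar xbar 0 u -> u = 0) ->
  isolated_calmness S pbar xbar.
Proof.
move=> dS0; apply/isolated_calmnessP.
apply: contrapT => not_calm.
have harm_gt0 k : 0 < harmonic k :> R by rewrite invr_gt0.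
(* The constant [(harmonic k)^-1] is violated on the radius [harmonic k]. *)
have viol k : exists px : 'rV[R]_l * 'rV[R]_n, let e := harmonic k in
    [/\ `|px.2 - xbar| < e, S px.1 px.2 &
        `|px.1 - pbar| < e * `|px.2 - xbar| ].
  apply: contrapT => no_viol; apply: not_calm.
  exists (harmonic k), (harmonic k)^-1.
  split; rewrite ?invr_ge0 ?ltW// => p x pe xe Spx.
  rewrite leNgt; apply/negP => lt; apply: no_viol; exists (p, x); split=> //=.
  by rewrite -ltr_pdivrMl// invr_gt0.
have {viol}[px pxP] := choice viol.
pose t_ k := `|(px k).2 - xbar|.
pose u_ k := (t_ k)^-1 *: ((px k).2 - xbar).
have t_gt0 k : 0 < t_ k.
  have [_ _ /(le_lt_trans (normr_ge0 _))] := pxP k.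
  by rewrite pmulr_rgt0// invr_gt0.
have u_unit k : `|u_ k| = 1.
  by rewrite normrZ gtr0_norm ?invr_gt0// mulVf// gt_eqF.
have sphere_compact : compact [set u : 'rV[R]_n | `|u| = 1].
  apply: bounded_closed_compact.
    exists 1; split; first exact: num_real.
    by move=> M M_gt1 u /= ->; exact: ltW.
  have -> : [set u : 'rV[R]_n | `|u| = 1] = Num.norm @^-1` [set 1] by [].
  apply: preimage_closed; last exact: closed_eq.
  by move=> x _; exact: norm_continuous.
have u_sphere : (u_ @ \oo) [set u : 'rV[R]_n | `|u| = 1].
  by exists 0%N => // k _; exact: u_unit.
have [u [/= u1 u_cluster]] := sphere_compact (u_ @ \oo) _ u_sphere.
suff u0 : u = 0 by move/eqP: u1; rewrite u0 normr0 eq_sym oner_eq0.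
apply: dS0; apply/tangent_coneP => e e_gt0.
have [N _ N_lt] := near_infty_natSinv_lt (PosNum e_gt0).
have [|w [[k /= Nk <-] uk]] :=
  u_cluster [set u_ k | k in [set k | (N <= k)%N]] (ball u e) _ (nbhsx_ballx _ _ e_gt0).
  by exists N => // k Nk; exists k.
have [xk Sk pk] := pxP k.
exists (t_ k), ((t_ k)^-1 *: ((px k).1 - pbar), u_ k); split.
- by rewrite t_gt0 (lt_trans xk)//; exact: N_lt.
- rewrite prod_normE /= gt_max sub0r normrN normrZ gtr0_norm ?invr_gt0//.
  rewrite -ball_normE in uk; rewrite uk andbT ltr_pdivrMl// mulrC.
  by apply: (lt_trans pk); rewrite ltr_pM2r ?(t_gt0 k) //; exact: N_lt.
- rewrite /gph /= !scalerA divff ?gt_eqF// !scale1r.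
  by rewrite ![_ + (_ - _)]addrC !subrK.
Qed.

Lemma isolated_calmness_graphical_derivativeP :
  isolated_calmness S pbar xbar <->
  forall u, graphical_derivative S pbar xbar 0 u -> u = 0.
Proof.
split; last exact: graphical_derivative_isolated_calmness.
by move=> calm u; exact: isolated_calmness_graphical_derivative.
Qed.

End Calmness.

(** * Tangents to a preimage *)

Section Subregularity.
Variables (R : realType) (Y Z : normedModType R) (NY : Y -> R) (NZ : Z -> R).
Hypothesis NYZ : forall t y, NY (t *: y) = `|t| * NY y.
Hypothesis NZZ : forall t z, NZ (t *: z) = `|t| * NZ z.
Hypothesis NY_ge : forall y, `|y| <= NY y.
Hypothesis NY_cont : continuous NY.
Hypothesis NZ_cont : continuous NZ.

(** The defining inequality of the cone is homogeneous in its argument, so the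
    factor [t_ k] drops out.  At [d0] its left-hand side vanishes while its
    right-hand side is positive, so by continuity it persists nearby. *)
Lemma dir_cone_near (rho delta : R) (d0 : Y) (d_ : nat -> Y) (t_ : nat -> R) :
  0 < rho -> 0 < delta -> d0 <> 0 -> d_ @ \oo --> d0 ->
  (forall k, 0 < t_ k) -> t_ @ \oo --> (0 : R) ->
  \forall k \near \oo, dir_cone NY rho delta d0 (t_ k *: d_ k).
Proof.
move=> rho_gt0 delta_gt0 d0_neq0 d_cvg t_gt0 t_cvg.
have NY0 : NY 0 = 0 by rewrite -(scale0r 0) NYZ normr0 mul0r.
have NY_gt0 : 0 < NY d0.
  by apply: lt_le_trans (NY_ge d0); rewrite normr_gt0; exact/eqP.
have NYd_cvg : NY (d_ k) @[k --> \oo] --> NY d0.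
  by apply: continuous_cvg; [exact: NY_cont|].
have in_ball : \forall k \near \oo, NY (t_ k *: d_ k) <= rho.
  have : NY (t_ k *: d_ k) @[k --> \oo] --> NY (0 *: d0).
    apply: continuous_cvg; first exact: NY_cont.
    exact: cvgZ.
  by rewrite scale0r NY0 => NY_td_cvg; exact: cvgr_le _ NY_td_cvg _ rho_gt0.
have in_dir : \forall k \near \oo,
    NY (NY d0 *: d_ k - NY (d_ k) *: d0) <= delta * NY d0 * NY (d_ k).
  have gap : delta * NY d0 * NY (d_ k) - NY (NY d0 *: d_ k - NY (d_ k) *: d0)
      @[k --> \oo] --> delta * NY d0 * NY d0 - NY (NY d0 *: d0 - NY d0 *: d0).
    apply: cvgB; first exact: cvgMr.
    apply: continuous_cvg; first exact: NY_cont.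
    by apply: cvgB; [exact: cvgZr|exact: cvgZl].
  rewrite subrr NY0 subr0 in gap.
  have gap_gt0 : 0 < delta * NY d0 * NY d0 by rewrite !mulr_gt0.
  by apply: filterS (cvgr_ge _ gap _ gap_gt0) => k; rewrite subr_ge0.
apply: filterS2 in_ball in_dir => k ball_k dir_k; have tk := t_gt0 k.
split=> //; rewrite NYZ gtr0_norm// scalerA [NY d0 * _]mulrC -!scalerA -scalerBr.
by rewrite NYZ gtr0_norm// mulrCA ler_pM2l.
Qed.

(** The points [ybar + t *: d] approximating [(d0, 0)] carry values of [F] at
    distance [o(t)] from [zbar]; subregularity replaces them by points of
    [F^-1(zbar)] at distance [o(t)], hence with the same limit direction. *)
Lemma subregular_dir_tangent (F : Y -> set Z) (ybar d0 : Y) (zbar : Z) :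
  d0 <> 0 -> graphical_derivative F ybar zbar d0 0 ->
  metrically_subregular_dir NY NZ F d0 ybar zbar ->
  tangent_cone (inverse_map F zbar) ybar d0.
Proof.
move=> d0_neq0 [w_ [t_ [w_cvg t_gt0 t_cvg Fw]]] [U [kappa [dirU kappa_ge0 subreg]]].
have [rho [delta [rho_gt0 delta_gt0 coneU]]] := dirU.
have NZ0 : NZ 0 = 0 by rewrite -(scale0r 0) NZZ normr0 mul0r.
pose d_ k := (w_ k).1; pose v_ k := (w_ k).2.
have d_cvg : d_ @ \oo --> d0 by apply: (cvg_comp _ _ w_cvg); exact: cvg_fst.
have v_cvg : v_ @ \oo --> 0 by apply: (cvg_comp _ _ w_cvg); exact: cvg_snd.
have cone_near := dir_cone_near rho delta d0 d_ t_ rho_gt0 delta_gt0 d0_neq0 d_cvg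
  t_gt0 t_cvg.
have small (e : R) : 0 < e -> \forall k \near \oo, kappa * NZ (- v_ k) < e.
  move=> e_gt0.
  have : kappa * NZ (- v_ k) @[k --> \oo] --> kappa * NZ (- 0).
    apply: cvgMr; apply: continuous_cvg; first exact: NZ_cont.
    exact: cvgN.
  by rewrite oppr0 NZ0 mulr0 => NZ_cvg; exact: cvgr_lt _ NZ_cvg _ e_gt0.
apply/tangent_coneP => e e_gt0.
have e2_gt0 : 0 < e / 2 by rewrite divr_gt0.
have t_near : \forall k \near \oo, `|t_ k| < e by exact: cvgr0_norm_lt.
have d_near : \forall k \near \oo, `|d0 - d_ k| < e / 2.
  by move/cvgrPdist_lt: d_cvg; exact.
have [k [[[t_lt d_lt] v_lt] in_cone]] := filter_ex (filterI
  (filterI (filterI t_near d_near) (small _ e2_gt0)) cone_near).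
have tk := t_gt0 k.
(* The distance to [F^-1(zbar)] may fail to be attained, hence the appeal to the
   strict bound [t_ k * (e / 2)]. *)
have [|_ [c Fc <-] c_lt] := @ereal_inf_lt R
    [set (NY (ybar + t_ k *: d_ k - c))%:E | c in inverse_map F zbar]
    (t_ k * (e / 2))%:E.
  apply: le_lt_trans (subreg _ (ex_intro2 _ _ _ (coneU _ in_cone) erefl)) _.
  apply: (@le_lt_trans _ _ (kappa%:E * (NZ (zbar - (zbar + t_ k *: v_ k)))%:E)%E).
    apply: lee_wpmul2l; first by rewrite lee_fin.
    apply: ereal_inf_lbound; exists (zbar + t_ k *: v_ k) => //; exact: Fw.
  rewrite opprD addNKr -scalerN NZZ gtr0_norm// -EFinM lte_fin mulrCA.
  by rewrite ltr_pM2l.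
rewrite lte_fin in c_lt.
exists (t_ k), ((t_ k)^-1 *: (c - ybar)); split.
- by rewrite tk -[t_ k]gtr0_norm.
- rewrite [e]splitr; apply: le_lt_trans (ler_distD (d_ k) _ _) _.
  rewrite ltrD// -(ltr_pM2l tk) -[X in X * `|_|]gtr0_norm// -normrZ scalerBr.
  rewrite scalerA divff ?gt_eqF// scale1r opprB addrA [_ + ybar]addrC.
  exact: le_lt_trans (NY_ge _) c_lt.
- by rewrite scalerA divff ?gt_eqF// scale1r addrC subrK.
Qed.

End Subregularity.

Lemma tangent_cone_inverse_map (R : realType) (Y Z : normedModType R)
    (F : Y -> set Z) (ybar d : Y) (zbar : Z) :
  tangent_cone (inverse_map F zbar) ybar d ->
  graphical_derivative F ybar zbar d 0.
Proof.
move=> /tangent_coneP approx; apply/tangent_coneP => e e_gt0.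
have [t [w [t_bd dw Fw]]] := approx e e_gt0.
exists t, (w, 0); split => //.
  by rewrite prod_normE /= subrr normr0 gt_max dw.
by rewrite /gph /= scaler0 addr0.
Qed.

Lemma gph_solution_map (R : realType) (l n m : nat)
    (M : 'rV[R]_l * 'rV[R]_n -> set 'rV[R]_m) :
  gph (solution_map M) = inverse_map M 0.
Proof. by apply/funext => -[p x]. Qed.

Theorem theorem3p1 (R : realType) (l n m : nat)
    (M : 'rV[R]_l * 'rV[R]_n -> set 'rV[R]_m)
    (pbar : 'rV[R]_l) (xbar : 'rV[R]_n)
    (hgph : gph M ((pbar, xbar), 0))
    (hclosed : locally_closed_around (gph M) ((pbar, xbar), 0)) :
  ((forall u : 'rV[R]_n,
      graphical_derivative M (pbar, xbar) 0 (0, u) 0 -> u = 0) ->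
   isolated_calmness (solution_map M) pbar xbar) /\
  ((exists u : 'rV[R]_n,
      [/\ u <> 0,
          graphical_derivative M (pbar, xbar) 0 (0, u) 0 &
          metrically_subregular_dir (@prod_enorm R l n) (@enorm R m)
            M (0, u) (pbar, xbar) 0]) ->
   ~ isolated_calmness (solution_map M) pbar xbar).
Proof.
split=> [dM0|[u [u_neq0 dMu subreg]]].
  apply/isolated_calmness_graphical_derivativeP => u.
  rewrite /graphical_derivative /= gph_solution_map => dSu.
  exact/dM0/tangent_cone_inverse_map.
move=> /isolated_calmness_graphical_derivativeP dS0; apply/u_neq0/dS0.
rewrite /graphical_derivative /= gph_solution_map.
apply: subregular_dir_tangent dMu subreg.
- exact: prod_enormZ.
- exact: enormZ.
- exact: normr_le_prod_enorm.
- exact: continuous_prod_enorm.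
- exact: continuous_enorm.
- by case.
Qed.
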